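(* Let $(X,R)$ be a countably infinite homogeneous relational structure whose automorphism group $\operatorname{Aut}(X,R)$ is oligomorphic. Let $w\in \operatorname{Aut}(X,R)\ast\mathbf F_r$ be a (reduced) word with constants of positive length. Assume that at least one of the following conditions holds: (i) $w$ is strong; (ii) $w$ has no non-trivial small critical constants and $(X,R)$ is algebraically convex; (iii) $w$ has no non-trivial slender critical constants. Then for every $n\in\mathbb N$ there exist a staggered algebraically independent tuple $(\alpha_1,\beta_1,\dots,\alpha_n,\beta_n)\in X^{2n}$ and $h_1,\dots,h_r\in\operatorname{Aut}(X,R)$ such that $\alpha_i.w(h_1,\dots,h_r)=\beta_i$ for all $i\in\{1,\dots,n\}$. In particular, $w$ is not a mixed identity for $\operatorname{Aut}(X,R)$.
   Context: Relational structures. A relational structure $(X,R)$ is a countable set $X$ with a family $R=(R_i)_{i\in I}$ of relations $R_i\subseteq X^{m_i}$. $\operatorname{Aut}(X,R)$ is the group of bijections $g$ of $X$ such that $(x_1,\dots,x_{m_i})\in R_i$ iff $(x_1.g,\dots,x_{m_i}.g)\in R_i$ for all $i$; it acts on $X$ from the right, $x\mapsto x.g$, so $x.(gh)=(x.g).h$. $(X,R)$ is homogeneous if every isomorphism between finite (induced) substructures extends to an automorphism. $\operatorname{Aut}(X,R)$ is oligomorphic if for every $n\in\mathbb N$ its componentwise action on $X^n$ has only finitely many orbits. For $Y\subseteq X$, $\operatorname{stab}(Y)$ is the pointwise stabilizer of $Y$ in $\operatorname{Aut}(X,R)$. ''Definable'' means first-order definable with parameters in $(X,R)$. The algebraic closure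 $\operatorname{acl}(Y)$ of $Y\subseteq X$ is the set of $x\in X$ such that $x.\operatorname{stab}(W)$ is finite for some finite $W\subseteq Y$. $(X,R)$ is algebraically convex if for every finite $Y\subseteq X$ and $x\in X$: $x\in\operatorname{acl}(\operatorname{acl}(Y\cup\{x\})\setminus\{x\})$ implies $x\in\operatorname{acl}(Y)$. An element $c\in\operatorname{Aut}(X,R)$ is small if $c\in\operatorname{stab}(Z)$ for some infinite definable $Z\subseteq X$. It is slender if there are a finite set $Y\subseteq X$ and an infinite definable set $Z\subseteq X$ with $Z\subseteq\{x\in X\mid x.c\in\operatorname{acl}(Y\cup\{x\})\}$. A tuple $(x_1,\dots,x_m)\in X^m$ is staggered algebraically independent if $x_i\notin\operatorname{acl}(\{x_1,\dots,x_{i-1}\})$ for every $i\in\{1,\dots,m\}$ (in particular $x_1\notin\operatorname{acl}(\varnothing)$). Words with constants. For a group $G$, a word with constants in variables $x_1,\dots,x_r$ is an element $w=c_0x_{\iota(1)}^{\varepsilon(1)}c_1\cdots c_{l-1}x_{\iota(l)}^{\varepsilon(l)}c_l\in G\ast\mathbf F_r$, where $\mathbf F_r=\langle x_1,\dots,x_r\rangle$ is free, $\varepsilon(j)\in\{\pm1\}$, $c_j\in G$. All words with constants are assumed reduced: if $\iota(j)=\iota(j+1)$ and $\varepsilon(j)=-\varepsilon(j+1)$ with $1\le j\le l-1$, then $c_j\notin\mathbf Z(G)$. The length of $w$ is $l$. An index $j\in\{1,\dots,l-1\}$ is critical if $\iota(j)=\iota(j+1)$ and $\varepsilon(j)=-\varepsilon(j+1)$;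 then $c_j$ is called a critical constant. $w$ is strong if it has no critical indices. For $g_1,\dots,g_r\in G$, $w(g_1,\dots,g_r)\in G$ is the image of $w$ under the homomorphism $G\ast\mathbf F_r\to G$ that is the identity on $G$ and sends $x_i\mapsto g_i$. $w$ is a mixed identity for $G$ if $w\ne1$ in $G\ast\mathbf F_r$ and $w(g_1,\dots,g_r)=1_G$ for all $g_1,\dots,g_r\in G$. *)

(* Defs.v *)
From HB Require Import structures.
From mathcomp Require Import all_boot.
From mathcomp Require Import boolp classical_sets functions cardinality.

Set Implicit Arguments.
Unset Strict Implicit.
Unset Printing Implicit Defensive.

Local Open Scope classical_set_scope.
Local Open Scope group_scope.

Record relStructure := RelStructure {
  dom :> countType;
  rsym : Type;
  arity : rsym -> nat;
  interp : forall i : rsym, set ('I_(arity i) -> dom)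
}.
Arguments interp : clear implicits.

Record aut (M : relStructure) := Aut {
  aut_fun :> M -> M;
  aut_bij : bijective aut_fun;
  aut_rel : forall (i : rsym M) (t : 'I_(arity i) -> M),
    interp M i t <-> interp M i (aut_fun \o t)
}.

Section AutGroup.
Variable M : relStructure.
Implicit Types g h : aut M.

HB.instance Definition _ := gen_eqMixin (aut M).
HB.instance Definition _ := gen_choiceMixin (aut M).

Lemma aut_ext g h : g =1 h -> g = h.
Proof.
case: g h => [f fb fr] [f' fb' fr'] /= /funext eqf.
by subst f'; rewrite (Prop_irrelevance fb fb') (Prop_irrelevance fr fr').
Qed.

Lemma aut_one_bij : bijective (@id M).
Proof. by exists id. Qed.

Definition aut_one : aut M := Aut aut_one_bij (fun i t => iff_refl _).

Lemma aut_mul_rel g h (i : rsym M) (t : 'I_(arity i) -> M) :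
  interp M i t <-> interp M i ((h \o g) \o t).
Proof. exact: iff_trans (aut_rel g t) (aut_rel h _). Qed.

(* Automorphisms act from the right: in the product [g * h], [g] acts first. *)
Definition aut_mul g h : aut M :=
  Aut (bij_comp (aut_bij h) (aut_bij g)) (@aut_mul_rel g h).

Lemma aut_inv_ex g : exists h, cancel g h /\ cancel h g.
Proof.
have [f fK gK] := aut_bij g.
have fbij : bijective f by exists g.
have frel (i : rsym M) (t : 'I_(arity i) -> M) :
    interp M i t <-> interp M i (f \o t).
  rewrite (aut_rel g (f \o t)); suff -> : g \o (f \o t) = t by [].
  by apply: funext => k /=; rewrite gK.
by exists (Aut fbij frel).
Qed.

Definition aut_inv g : aut M := sval (cid (aut_inv_ex g)).

Lemma aut_mulA : associative aut_mul.
Proof. by move=> g h k; apply: aut_ext. Qed.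

Lemma aut_mul1 : left_id aut_one aut_mul.
Proof. by move=> g; apply: aut_ext. Qed.

Lemma aut_mulr1 : right_id aut_one aut_mul.
Proof. by move=> g; apply: aut_ext. Qed.

Lemma aut_mulV : left_inverse aut_one aut_inv aut_mul.
Proof.
move=> g; apply: aut_ext => x; rewrite /aut_inv.
by case: cid => h [gK hK] /=; exact: hK.
Qed.

Lemma aut_mulrV : right_inverse aut_one aut_inv aut_mul.
Proof.
move=> g; apply: aut_ext => x; rewrite /aut_inv.
by case: cid => h [gK hK] /=; exact: gK.
Qed.

HB.instance Definition _ := isGroup.Build (aut M)
  aut_mulA aut_mul1 aut_mulr1 aut_mulV aut_mulrV.

Lemma aut1E x : (1 : aut M) x = x. Proof. by []. Qed.

Lemma autME g h x : (g * h) x = h (g x). Proof. by []. Qed.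

End AutGroup.

Section ModelTheory.
Variable M : relStructure.

Definition partial_iso (A B : set M) (f : M -> M) : Prop :=
  set_bij A B f /\
  forall (i : rsym M) (t : 'I_(arity i) -> M),
    (forall k, A (t k)) -> interp M i t <-> interp M i (f \o t).

Definition homogeneous : Prop :=
  forall (A B : set M) (f : M -> M),
    finite_set A -> finite_set B -> partial_iso A B f ->
    exists g : aut M, forall x, A x -> g x = f x.

Definition tuple_orbit n (t : 'I_n -> M) : set ('I_n -> M) :=
  [set u | exists g : aut M, u = g \o t].

Definition oligomorphic : Prop :=
  forall n : nat, finite_set (range (@tuple_orbit n)).

Definition stab (Y : set M) : set (aut M) :=
  [set g | forall y, Y y -> g y = y].

Definition acl (Y : set M) : set M :=
  [set x | exists W : set M, [/\ finite_set W, W `<=` Y &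
     finite_set [set (g : aut M) x | g in stab W]]].

(* First-order formulas whose free variables are among [n] variables; under a
   quantifier the bound variable has index [ord0]. *)
Inductive formula : nat -> Type :=
| FRel n (i : rsym M) (v : 'I_(arity i) -> 'I_n) : formula n
| FEq n (j k : 'I_n) : formula n
| FNot n (p : formula n) : formula n
| FAnd n (p q : formula n) : formula n
| FEx n (p : formula n.+1) : formula n.

Definition env_cons n (x : M) (e : 'I_n -> M) : 'I_n.+1 -> M :=
  fun j => if unlift ord0 j is Some k then e k else x.

Fixpoint sat n (p : formula n) : ('I_n -> M) -> Prop :=
  match p with
  | FRel _ i v => fun e => interp M i (e \o v)
  | FEq _ j k => fun e => e j = e k
  | FNot _ p => fun e => ~ sat p e
  | FAnd _ p q => fun e => sat p e /\ sat q e
  | FEx _ p => fun e => exists x : M, sat p (env_cons x e)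
  end.

Definition definable (Z : set M) : Prop :=
  exists (k : nat) (p : formula k.+1) (a : 'I_k -> M),
    Z = [set x | sat p (env_cons x a)].

Definition algebraically_convex : Prop :=
  forall (Y : set M) (x : M), finite_set Y ->
    acl (acl (Y `|` [set x]) `\ x) x -> acl Y x.

Definition small (c : aut M) : Prop :=
  exists Z : set M, [/\ infinite_set Z, definable Z & stab Z c].

Definition slender (c : aut M) : Prop :=
  exists Y Z : set M, [/\ finite_set Y, infinite_set Z, definable Z &
    Z `<=` [set x | acl (Y `|` [set x]) (c x)]].

Definition staggered_independent m (x : 'I_m -> M) : Prop :=
  forall i : 'I_m, ~ acl [set x j | j in [set j : 'I_m | (j < i)%N]] (x i).

End ModelTheory.

Lemma half_ord_proof n (k : 'I_n.*2) : (k./2 < n)%N.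
Proof. by rewrite ltn_half_double. Qed.

Definition half_ord n (k : 'I_n.*2) : 'I_n := Ordinal (half_ord_proof k).

(* The tuple (a_1, b_1, ..., a_n, b_n). *)
Definition interleave (T : Type) n (a b : 'I_n -> T) : 'I_n.*2 -> T :=
  fun k => if odd k then b (half_ord k) else a (half_ord k).

(* [freeProd G r] is the free product of [G] and the free group on
   x_0, ..., x_(r-1): sequences of letters [inl c] (c in G) and [inr (i, s)]
   (meaning x_i if [s = false] and x_i^-1 if [s = true]), modulo the relations
   of the free product. *)
Section FreeProduct.
Variables (G : groupType) (r : nat).

Definition letter : Type := (G + ('I_r * bool))%type.
HB.instance Definition _ := Choice.on letter.

Inductive fp_equiv : seq letter -> seq letter -> Prop :=
| fp_const_mul s1 s2 (c d : G) :
    fp_equiv (s1 ++ [:: inl c; inl d] ++ s2) (s1 ++ [:: inl (c * d)] ++ s2)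
| fp_const_one s1 s2 : fp_equiv (s1 ++ [:: inl 1] ++ s2) (s1 ++ s2)
| fp_var_inv s1 s2 (i : 'I_r) (s : bool) :
    fp_equiv (s1 ++ [:: inr (i, s); inr (i, ~~ s)] ++ s2) (s1 ++ s2)
| fp_refl s : fp_equiv s s
| fp_sym s t : fp_equiv s t -> fp_equiv t s
| fp_trans s t u : fp_equiv s t -> fp_equiv t u -> fp_equiv s u.

Definition fp_rel : rel (seq letter) := fun s t => `[< fp_equiv s t >].

Lemma fp_rel_refl : reflexive fp_rel.
Proof. by move=> s; apply/asboolP; exact: fp_refl. Qed.

Lemma fp_rel_sym : symmetric fp_rel.
Proof. by move=> s t; apply/asboolP/asboolP; exact: fp_sym. Qed.

Lemma fp_rel_trans : transitive fp_rel.
Proof.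
by move=> t s u /asboolP st /asboolP tu; apply/asboolP; exact: fp_trans st tu.
Qed.

Canonical fp_rel_equiv := EquivRel fp_rel fp_rel_refl fp_rel_sym fp_rel_trans.

Definition freeProd : Type := {eq_quot fp_rel}%qT.
HB.instance Definition _ := Choice.on freeProd.

Definition fp_pi (s : seq letter) : freeProd := (\pi_({eq_quot fp_rel}) s)%qT.
Definition fp_repr (u : freeProd) : seq letter :=
  @repr _ {eq_quot fp_rel}%qT u.

Lemma fp_reprK : cancel fp_repr fp_pi.
Proof. exact: reprK. Qed.

Lemma fp_piP s t : fp_pi s = fp_pi t <-> fp_equiv s t.
Proof.
split=> [st|st]; first by apply/asboolP/(eqquotP {eq_quot fp_rel}%qT).
by apply/(eqquotP {eq_quot fp_rel}%qT)/asboolP.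
Qed.

Lemma fp_repr_pi s : fp_equiv (fp_repr (fp_pi s)) s.
Proof. by apply/fp_piP; rewrite fp_reprK. Qed.

Lemma fp_equiv_catl s t u : fp_equiv s t -> fp_equiv (s ++ u) (t ++ u).
Proof.
elim=> {s t} [s1 s2 c d|s1 s2|s1 s2 i s|s|s t _|s t v _ IH1 _ IH2].
- by rewrite -!catA; exact: fp_const_mul.
- by rewrite -!catA; exact: fp_const_one.
- by rewrite -!catA; exact: fp_var_inv.
- exact: fp_refl.
- exact: fp_sym.
- exact: fp_trans IH1 IH2.
Qed.

Lemma fp_equiv_catr s t u : fp_equiv s t -> fp_equiv (u ++ s) (u ++ t).
Proof.
elim=> {s t} [s1 s2 c d|s1 s2|s1 s2 i s|s|s t _|s t v _ IH1 _ IH2].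
- by rewrite ![u ++ s1 ++ _]catA; exact: fp_const_mul.
- by rewrite ![u ++ s1 ++ _]catA; exact: fp_const_one.
- by rewrite ![u ++ s1 ++ _]catA; exact: fp_var_inv.
- exact: fp_refl.
- exact: fp_sym.
- exact: fp_trans IH1 IH2.
Qed.

Lemma fp_equiv_cat s s' t t' :
  fp_equiv s s' -> fp_equiv t t' -> fp_equiv (s ++ t) (s' ++ t').
Proof.
by move=> ss' tt'; apply: fp_trans (fp_equiv_catl _ ss') (fp_equiv_catr _ tt').
Qed.

Definition letter_inv (x : letter) : letter :=
  match x with inl c => inl c^-1 | inr (i, s) => inr (i, ~~ s) end.

Definition letters_inv (s : seq letter) : seq letter := rev (map letter_inv s).

Lemma letter_invK : involutive letter_inv.
Proof. by case=> [c|[i s]] /=; rewrite ?invgK ?negbK. Qed.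

Lemma letters_invK : involutive letters_inv.
Proof. by move=> s; rewrite /letters_inv map_rev revK mapK //; exact: letter_invK. Qed.

Lemma fp_letter_mulV s1 x s2 :
  fp_equiv (s1 ++ [:: x; letter_inv x] ++ s2) (s1 ++ s2).
Proof.
case: x => [c|[i s]]; last exact: fp_var_inv.
apply: fp_trans (fp_const_mul _ _ _ _) _.
by rewrite mulgV; exact: fp_const_one.
Qed.

Lemma fp_equiv_mulV s : fp_equiv (s ++ letters_inv s) [::].
Proof.
elim/last_ind: s => [|s x IH]; first exact: fp_refl.
rewrite /letters_inv map_rcons rev_rcons cat_rcons.
exact: fp_trans (fp_letter_mulV s x _) IH.
Qed.

Definition fp_mul (u v : freeProd) : freeProd := fp_pi (fp_repr u ++ fp_repr v).
Definition fp_one : freeProd := fp_pi [::].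
Definition fp_inv (u : freeProd) : freeProd := fp_pi (letters_inv (fp_repr u)).

Lemma fp_mul_pi s t : fp_mul (fp_pi s) (fp_pi t) = fp_pi (s ++ t).
Proof. by apply/fp_piP/fp_equiv_cat; exact: fp_repr_pi. Qed.

Lemma fp_mulA : associative fp_mul.
Proof.
move=> u v w; rewrite -[u]fp_reprK -[v]fp_reprK -[w]fp_reprK.
by rewrite !fp_mul_pi catA.
Qed.

Lemma fp_mul1 : left_id fp_one fp_mul.
Proof. by move=> u; rewrite -[u]fp_reprK fp_mul_pi. Qed.

Lemma fp_mulr1 : right_id fp_one fp_mul.
Proof. by move=> u; rewrite -[u]fp_reprK fp_mul_pi cats0. Qed.

Lemma fp_mulrV : right_inverse fp_one fp_inv fp_mul.
Proof.
move=> u; rewrite /fp_inv -{1}[u]fp_reprK fp_mul_pi.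
exact/fp_piP/fp_equiv_mulV.
Qed.

Lemma fp_mulV : left_inverse fp_one fp_inv fp_mul.
Proof.
move=> u; rewrite /fp_inv -{2}[u]fp_reprK fp_mul_pi; apply/fp_piP.
by rewrite -{2}[fp_repr u]letters_invK; exact: fp_equiv_mulV.
Qed.

HB.instance Definition _ := isGroup.Build freeProd
  fp_mulA fp_mul1 fp_mulr1 fp_mulV fp_mulrV.

Definition fp_const (c : G) : freeProd := fp_pi [:: inl c].
Definition fp_var (i : 'I_r) : freeProd := fp_pi [:: inr (i, false)].

Lemma fp_piM s t : fp_pi (s ++ t) = fp_pi s * fp_pi t.
Proof. by rewrite [RHS]fp_mul_pi. Qed.

Lemma fp_constM : {morph fp_const : c d / c * d}.
Proof.
move=> c d; rewrite [RHS]fp_mul_pi /fp_const; apply/fp_piP/fp_sym.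
exact: (fp_const_mul [::] [::]).
Qed.

Section Evaluation.
Variable g : 'I_r -> G.

Definition letter_eval (x : letter) : G :=
  match x with inl c => c | inr (i, s) => if s then (g i)^-1 else g i end.

Definition letters_eval (s : seq letter) : G :=
  foldr (fun x y => letter_eval x * y) 1 s.

(* The homomorphism to G that is the identity on G and maps x_i to g_i. *)
Definition fp_eval (u : freeProd) : G := letters_eval (fp_repr u).

Lemma letters_eval_cat s t :
  letters_eval (s ++ t) = letters_eval s * letters_eval t.
Proof. by elim: s => [|x s IH] /=; rewrite ?mul1g // IH mulgA. Qed.

Lemma letters_eval_equiv s t :
  fp_equiv s t -> letters_eval s = letters_eval t.
Proof.
elim=> {s t} [s1 s2 c d|s1 s2|s1 s2 i s|s|s t _|s t v _ IH1 _ IH2] //.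
- by rewrite !letters_eval_cat /= !mulg1.
- by rewrite !letters_eval_cat /= !mulg1 mul1g.
- by rewrite !letters_eval_cat /=; case: s; rewrite /= ?mulg1 ?mulVg ?mulgV mul1g.
- by rewrite IH1.
Qed.

Lemma fp_eval_pi s : fp_eval (fp_pi s) = letters_eval s.
Proof. exact/letters_eval_equiv/fp_repr_pi. Qed.

Lemma fp_eval_is_morphism : monoid_morphism fp_eval.
Proof.
split=> [|u v]; first by rewrite [LHS]fp_eval_pi.
by rewrite [LHS]fp_eval_pi letters_eval_cat.
Qed.

HB.instance Definition _ :=
  isUMagmaMorphism.Build freeProd G fp_eval fp_eval_is_morphism.

Lemma fp_eval_const c : fp_eval (fp_const c) = c.
Proof. by rewrite fp_eval_pi /= mulg1. Qed.

Lemma fp_eval_var i : fp_eval (fp_var i) = g i.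
Proof. by rewrite fp_eval_pi /= mulg1. Qed.

End Evaluation.

Definition mixed_identity (u : freeProd) : Prop :=
  u <> 1 /\ forall g : 'I_r -> G, fp_eval g u = 1.

End FreeProduct.

(* [Word c0 [:: (i_1, s_1, c_1); ...; (i_l, s_l, c_l)]] is the expression
   c0 x_(i_1)^(e_1) c_1 ... x_(i_l)^(e_l) c_l, where e_j is 1 if [s_j = false]
   and -1 if [s_j = true]. *)
Record word (G : groupType) (r : nat) := Word {
  wconst0 : G;
  wblocks : seq ('I_r * bool * G)
}.

Section Words.
Variables (G : groupType) (r : nat).
Implicit Type w : word G r.

Definition wlength w : nat := size (wblocks w).

Definition block_elt (b : 'I_r * bool * G) : freeProd G r :=
  let: (i, s, c) := b in
  (if s then (fp_var G i)^-1 else fp_var G i) * fp_const r c.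

Definition word_elt w : freeProd G r :=
  foldl (fun u b => u * block_elt b) (fp_const r (wconst0 w)) (wblocks w).

(* Positions are counted from 1: [j] is a critical index of [w], and [c] is
   the constant c_j. *)
Definition critical w (j : nat) (c : G) : Prop :=
  exists (p q : seq ('I_r * bool * G)) (i : 'I_r) (s : bool) (d : G),
    wblocks w = p ++ (i, s, c) :: (i, ~~ s, d) :: q /\ j = (size p).+1.

Definition in_center (c : G) : Prop := forall g : G, commute c g.

Definition reduced w : Prop :=
  forall (j : nat) (c : G), critical w j c -> ~ in_center c.

Definition strong w : Prop := forall (j : nat) (c : G), ~ critical w j c.

Definition no_nontrivial_critical (P : G -> Prop) w : Prop :=
  forall (j : nat) (c : G), critical w j c -> c <> 1 -> ~ P c.

End Words.

(* Main.v *)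
Require Import Defs.
From HB Require Import structures.
From mathcomp Require Import all_boot.
From mathcomp Require Import boolp classical_sets functions cardinality.

Set Implicit Arguments.
Unset Strict Implicit.
Unset Printing Implicit Defensive.

(* Generate a path alpha -> ... -> beta letter by letter, keeping for each
   variable an automorphism of which only a finite part is frozen.  A point q
   reached by a new application of x^e may be moved within its infinite orbit
   under the stabilizer of the frozen points B, so c q can avoid any prescribed
   finite set, in particular the algebraic closure of the domain of the next
   letter.  Only at a critical index does that domain, now B and q, depend on q;
   if then c q always lies in acl(B, q), the orbit of q shows that c is slender,
   and under algebraic convexity even that c is small. *)

Local Open Scope classical_set_scope.
Local Open Scope group_scope.

(** * Enumerated finite sets and variable environments *)

Lemma finite_set_range (T : eqType) (Y : set T) :
  finite_set Y -> exists (k : nat) (a : 'I_k -> T), Y = range a.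
Proof.
move=> /finite_seqP[s ->]; exists (size s), (fun i => tnth (in_tuple s) i).
apply/seteqP; split=> [x /= /(tnthP (in_tuple s))[i ->]|_ [i _ <-]] /=.
  by exists i.
exact: mem_tnth.
Qed.

Lemma env_cons0 (M : relStructure) n x (e : 'I_n -> M) :
  env_cons x e ord0 = x.
Proof. by rewrite /env_cons unlift_none. Qed.

Lemma env_consS (M : relStructure) n x (e : 'I_n -> M) i :
  env_cons x e (lift ord0 i) = e i.
Proof. by rewrite /env_cons liftK. Qed.

Lemma comp_env_cons (M : relStructure) (f : M -> M) n x (e : 'I_n -> M) :
  f \o env_cons x e = env_cons (f x) (f \o e).
Proof. by apply/funext => i; rewrite /env_cons /=; case: unlift. Qed.

(** * Automorphisms, stabilizer orbits and algebraic closure *)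

Section Aut.
Variable M : relStructure.
Implicit Types (g : aut M) (Y : set M) (x : M).

Lemma autK g : cancel g (g^-1%g : aut M).
Proof. by move=> x; rewrite -autME mulgV. Qed.

Lemma autVK g : cancel (g^-1%g : aut M) g.
Proof. by move=> x; rewrite -autME mulVg. Qed.

Lemma aut_inj g : injective g.
Proof. exact: can_inj (autK g). Qed.

Lemma sat_aut g n (p : formula M n) e : sat p (g \o e) <-> sat p e.
Proof.
elim: p e => {n} /= [n i v|n j k|n p IH|n p IHp q IHq|n p IH] e.
- exact: iff_sym (aut_rel g _).
- by split=> [/aut_inj|->].
- by split=> np /IH.
- by split=> -[/IHp ? /IHq].
- split=> [] [x]; last first.
    by move=> px; exists (g x); rewrite -comp_env_cons IH.
  move=> px; exists ((g^-1%g : aut M) x); apply/IH.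
  by rewrite comp_env_cons autVK.
Qed.

Lemma stabV Y g : stab Y g -> stab Y g^-1.
Proof. by move=> gY y Yy; rewrite -{1}(gY y Yy) autK. Qed.

Lemma stabM Y g g' : stab Y g -> stab Y g' -> stab Y (g * g').
Proof. by move=> gY g'Y y Yy; rewrite autME gY // g'Y. Qed.

Lemma stabS Y Y' : Y `<=` Y' -> stab Y' `<=` stab Y.
Proof. by move=> YY' g gY' y /YY'; exact: gY'. Qed.

Definition stab_orbit Y x : set M := [set (g : aut M) x | g in stab Y].

Lemma stab_orbitS Y Y' x : Y `<=` Y' -> stab_orbit Y' x `<=` stab_orbit Y x.
Proof. by move=> YY' _ [g gY' <-]; exists g => //; exact: stabS gY'. Qed.

Lemma stab_orbit_eq Y x y : stab_orbit Y x y -> stab_orbit Y y = stab_orbit Y x.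
Proof.
move=> [g gY <-]; apply/seteqP; split=> _ [k kY <-].
  by exists (g * k); [exact: stabM|].
exists (g^-1 * k); last by rewrite autME autK.
by apply: stabM => //; exact: stabV.
Qed.

(** Orbits under the stabilizer of the parameters are fibres of orbits of whole tuples; this
    transfers oligomorphy and definability to them. *)
Lemma env_cons_orbit k (a : 'I_k -> M) q x :
  tuple_orbit (env_cons q a) (env_cons x a) <-> stab_orbit (range a) q x.
Proof.
split=> [[g eqg]|[g ga <-]]; exists g.
- move=> _ [i _ <-]; have := congr1 (fun f => f (lift ord0 i)) eqg.
  by rewrite /= !env_consS.
- by have := congr1 (fun f => f ord0) eqg; rewrite /= !env_cons0.
- rewrite comp_env_cons; congr env_cons; apply/funext => i /=.
  by rewrite ga //; exists i.
Qed.

Lemma aclP Y x : finite_set Y -> acl Y x <-> finite_set (stab_orbit Y x).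
Proof.
move=> finY; split=> [[W [_ WY]]|finO]; last by exists Y; split.
by apply: sub_finite_set; exact: stab_orbitS.
Qed.

Lemma aclS Y Y' : Y `<=` Y' -> acl Y `<=` acl Y'.
Proof.
by move=> YY' x [W [? WY ?]]; exists W; split=> //; exact: subset_trans YY'.
Qed.

Lemma sub_acl Y : Y `<=` acl Y.
Proof.
move=> x Yx; exists [set x]; split=> [||]; first exact: finite_set1.
  by move=> _ ->.
apply: (sub_finite_set _ (finite_set1 x)) => _ [g gx <-] /=.
exact: gx.
Qed.

(** Conjugation by [g] carries [stab W] onto the stabilizer of the image of [W], and hence finite
    orbits to finite orbits. *)
Lemma acl_aut g Y x : acl Y x -> acl (g @` Y) (g x).
Proof.
move=> [W [finW WY finO]]; exists (g @` W).
split; [exact: finite_image|exact: image_subset|].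
apply: sub_finite_set (finite_image g finO) => _ [k kW <-] /=.
exists ((g * k * g^-1) x); last by rewrite !autME autVK.
by exists (g * k * g^-1) => // y Wy; rewrite !autME kW ?autK.
Qed.

Lemma image_autK g Y : (g^-1%g : aut M) @` (g @` Y) = Y.
Proof. by rewrite image_comp; apply: eq_image_id => y _; exact: autK. Qed.

Lemma not_acl_aut g Y x : ~ acl Y x -> ~ acl (g @` Y) (g x).
Proof.
move=> nYx gYx; apply: nYx; rewrite -(image_autK g Y) -(autK g x).
exact: acl_aut.
Qed.

End Aut.

(** * Finiteness of closures and definability of stabilizer orbits *)

Section Oligomorphic.
Variables (M : relStructure) (oligoM : oligomorphic M).
Implicit Types (Y F : set M) (q x : M) (c : aut M).

(** The closure is a union of finite stabilizer orbits, and there are finitely many of these because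
    each is cut out by one of the finitely many orbits on [k.+1]-tuples. *)
Lemma finite_acl Y : finite_set Y -> finite_set (acl Y).
Proof.
move=> finY; have [k [a Ya]] := finite_set_range finY.
pose O x := tuple_orbit (env_cons x a).
have -> : acl Y = \bigcup_(S in O @` acl Y) [set y | S (env_cons y a)].
  apply/seteqP; split=> [x Yx|x [_ [y Yy <-]]] /=.
    by exists (O x); [exists x|exists 1; exact/funext].
  move=> /env_cons_orbit; rewrite -Ya => yx.
  by apply/aclP => //; rewrite (stab_orbit_eq yx); exact/aclP.
apply: bigcup_finite => [|_ [y Yy <-]].
  apply: sub_finite_set (oligoM k.+1) => _ [x _ <-].
  by exists (env_cons x a).
have -> : [set x | O y (env_cons x a)] = stab_orbit Y y.
  by apply/seteqP; split=> x /=; rewrite Ya => /env_cons_orbit.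
exact/aclP.
Qed.

Lemma stab_orbit_escape Y F q : finite_set Y -> finite_set F -> ~ acl Y q ->
  exists2 t, stab Y t & ~ F (t q).
Proof.
move=> finY finF /(aclP _ finY) infO.
have [_ [[t tY <-] nF]] := infinite_setN0 (infinite_setD infO finF).
by exists t.
Qed.

Hypothesis homM : homogeneous M.

(** If no atomic formula tells the tuples apart, matching their entries is a partial isomorphism,
    which homogeneity extends. *)
Lemma separating_formula n (e0 e : 'I_n -> M) : ~ tuple_orbit e0 e ->
  exists p : formula M n, sat p e0 /\ ~ sat p e.
Proof.
move=> nO; apply: contrapT => nosep; apply: nO.
have sepN (p : formula M n) : sat p e0 <-> sat p e.
  split=> pe; apply: contrapT => npe; apply: nosep; first by exists p.
  by exists (FNot p); split=> //=; apply.
have eqe j k : e0 j = e0 k <-> e j = e k := sepN (FEq _ j k).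
pose f x := if pselect (exists j, e0 j = x) is left ex
            then e (projT1 (cid ex)) else x.
have fe j : f (e0 j) = e j.
  rewrite /f; case: pselect => [ex|[]]; last by exists j.
  by case: cid => k /= /eqe.
have [|||g ge] := @homM (range e0) (range e) f.
- exact: finite_image.
- exact: finite_image.
- split; first split.
  + by move=> _ [j _ <-]; exists j => //; rewrite fe.
  + move=> _ _ /set_mem[j _ <-] /set_mem[k _ <-].
    by rewrite !fe => /eqe.
  + by move=> _ [j _ <-]; exists (e0 j); [exists j|rewrite fe].
  move=> i t tA; have /choice[v ve] : forall k, exists j, e0 j = t k.
    by move=> k; have [j _ <-] := tA k; exists j.
  have -> : t = e0 \o v by apply/funext => k /=; rewrite ve.
  have -> : f \o (e0 \o v) = e \o v by apply/funext => k /=; rewrite fe.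
  exact: (sepN (FRel v)).
by exists g; apply/funext => j /=; rewrite ge ?fe //; exists j.
Qed.

(** The formula is a conjunction of separating formulas, one for each of the finitely many other
    orbits. *)
Lemma isolating_formula n (e0 : 'I_n.+1 -> M) :
  exists p : formula M n.+1, forall e, sat p e <-> tuple_orbit e0 e.
Proof.
have e0e0 : tuple_orbit e0 e0 by exists 1; exact/funext.
have /finite_seqP[s sE] := @oligoM n.+1.
have sS e : tuple_orbit e \in s.
  have : range (@tuple_orbit M n.+1) (tuple_orbit e) by exists e.
  by rewrite sE.
have [p [pe0 pN]] : exists p : formula M n.+1, sat p e0 /\
    forall e, tuple_orbit e \in s -> ~ tuple_orbit e0 e -> ~ sat p e.
  elim: s {sE sS} => [|O s [p [pe0 pN]]].
    by exists (FEq _ ord0 ord0).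
  have [[e1 [Oe1 ne1]]|none] :=
      pselect (exists e1, O = tuple_orbit e1 /\ ~ tuple_orbit e0 e1).
    have [p1 [p1e0 np1]] := separating_formula ne1.
    exists (FAnd p p1); split=> // e; rewrite inE => /orP[/eqP eO _ [_ p1e]|].
      have [g eg] : tuple_orbit e1 e.
        by rewrite -Oe1 -eO; exists 1; exact/funext.
      by apply: np1; apply/(sat_aut g); rewrite -eg.
    by move=> es ne [pe _]; exact: pN es ne pe.
  exists p; split=> // e; rewrite inE => /orP[/eqP eO ne|]; last exact: pN.
  by case: none; exists e.
exists p => e; split=> [pe|[g ->]]; last exact/sat_aut.
by apply: contrapT => ne; exact: pN (sS e) ne pe.
Qed.

Lemma definable_stab_orbit Y q : finite_set Y -> definable (stab_orbit Y q).
Proof.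
move=> /finite_set_range[k [a ->]].
have [p pP] := isolating_formula (env_cons q a).
exists k, p, a; apply/seteqP; split=> x /=.
  by move=> /env_cons_orbit/pP.
by move=> /pP/env_cons_orbit.
Qed.

End Oligomorphic.

(** * Constants that escape closures, and their relation to slender and small ones *)

Section Evasion.
Variables (M : relStructure) (oligoM : oligomorphic M).
Implicit Types (B F : set M) (q : M) (c : aut M).

Definition evasive c := forall B F q,
  finite_set B -> finite_set F -> ~ acl B q ->
  exists t, [/\ stab B t, ~ F (t q) & ~ acl (B `|` [set t q]) (c (t q))].

(** Adding [F] to [B] and moving [q] outside the closure of the union makes the whole new orbit
    avoid [F], so only the closure condition can fail there. *)
Lemma non_evasive_orbit c : ~ evasive c -> exists B q,
  [/\ finite_set B, ~ acl B q &
      stab_orbit B q `<=` [set x | acl (B `|` [set x]) (c x)]].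
Proof.
move=> nev; apply: contrapT => none; apply: nev => B F q finB finF nBq.
apply: contrapT => stuck; apply: none.
have finBF : finite_set (B `|` F) by rewrite finite_setU.
have [t tB nBFtq] := stab_orbit_escape finB (finite_acl oligoM finBF) nBq.
exists (B `|` F), (t q); split=> // _ [s sBF <-] /=.
apply: contrapT => nacl; apply: stuck; exists (t * s); split.
- by apply: stabM => // y By; apply: sBF; left.
- move=> Fsq; apply: nBFtq; apply: sub_acl; right.
  suff -> : t q = s (t q) by [].
  by apply: (@aut_inj _ s); rewrite [RHS]sBF //; right.
- by move=> acls; apply: nacl; apply: aclS acls => y [|->]; [left; left|right].
Qed.

Hypothesis homM : homogeneous M.

Lemma infinite_stab_orbit B q :
  finite_set B -> ~ acl B q -> infinite_set (stab_orbit B q).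
Proof. by move=> finB nBq finO; apply/nBq/aclP. Qed.

Lemma evasive_of_not_slender c : ~ slender c -> evasive c.
Proof.
move=> nsl; apply: contrapT => /non_evasive_orbit[B [q [finB nBq sub]]].
apply: nsl; exists B, (stab_orbit B q); split=> //.
  exact: infinite_stab_orbit.
exact: definable_stab_orbit.
Qed.

(* By convexity [q] still has an infinite orbit when the rest [C] of
   [acl (B, q)] is fixed, and every [x] in that orbit has
   [acl (B, x) = C, x].  As [c] is injective, [c x] lies in the finite set [C]
   only finitely often, so that [c x = x] for most [x]. *)
Lemma evasive_of_not_small c :
  algebraically_convex M -> ~ small c -> evasive c.
Proof.
move=> convM nsm; apply: contrapT => /non_evasive_orbit[B [q [finB nBq sub]]].
apply: nsm; pose C := acl (B `|` [set q]) `\ q.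
have finBq : finite_set (B `|` [set q]).
  by rewrite finite_setU; split=> //; exact: finite_set1.
have finC : finite_set C by apply: finite_setD; exact: finite_acl.
have nCq : ~ acl C q by move=> Cq; apply: nBq; exact: convM finB Cq.
have BC : B `<=` C.
  move=> y By; split; first by apply: sub_acl; left.
  by move=> yq; apply: nBq; apply: sub_acl; rewrite -[q]yq.
(* [E] also contains the points that [c] sends into [C]; fixing [E] keeps the orbit chosen below off
   it. *)
pose E := C `|` (c^-1%g : aut M) @` C.
have finE : finite_set E.
  by rewrite finite_setU; split=> //; exact: finite_image.
have [t tC nEtq] := stab_orbit_escape finC (finite_acl oligoM finE) nCq.
exists (stab_orbit E (t q)); split.
- exact: infinite_stab_orbit.
- exact: definable_stab_orbit.
move=> _ [s sE <-]; pose k := t * s.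
have kC : stab C k by apply: stabM => // y Cy; apply: sE; left.
have kB : stab B k by exact: stabS kC.
have nEk : ~ E (k q).
  move=> Ekq; apply: nEtq; apply: sub_acl.
  suff -> : t q = k q by [].
  by apply: (@aut_inj _ s); rewrite [RHS]sE.
have : acl (B `|` [set k q]) (c (k q)) by apply: sub; exists k.
(* Pulling back by [k], which fixes [B], shows that the preimage of [c (k q)] is [q] or lies in
   [C]. *)
move=> /(acl_aut k^-1%g).
have -> : (k^-1%g : aut M) @` (B `|` [set k q]) = B `|` [set q].
  rewrite image_setU image_set1 autK; congr (_ `|` _).
  by apply: eq_image_id; exact: stabV.
have [eq _|neq acl_c] := pselect ((k^-1%g : aut M) (c (k q)) = q).
  by rewrite -[RHS]autME -/k -[in RHS]eq autVK.
have Cc : C ((k^-1%g : aut M) (c (k q))) by split.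
(* [k] fixes [C] pointwise, so [c (k q)] itself lies in [C], which [E] excludes. *)
case: nEk; right; exists (c (k q)); last exact: autK.
by rewrite -(autVK k (c (k q))) kC.
Qed.

End Evasion.

(** * Building paths from partly frozen automorphisms *)

Section Path.
Variables (M : relStructure) (r : nat).
Implicit Types (h : 'I_r -> aut M) (D : 'I_r -> set M) (i : 'I_r) (s : bool).
Implicit Types (bs : seq ('I_r * bool * aut M)) (p q : M).

Definition signed h i s : aut M := if s then (h i)^-1 else h i.

(* [h i] is frozen on [D i]: this is the domain of the frozen part of
   [signed h i s]. *)
Definition signed_dom h D i s : set M := if s then h i @` D i else D i.

Definition eval_blocks h bs p : M :=
  foldl (fun x (b : 'I_r * bool * aut M) => b.2 (signed h b.1.1 b.1.2 x)) p bs.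

Definition agree D h h' := forall i x, D i x -> h' i x = h i x.

Lemma fp_eval_word_elt h (w : word (aut M) r) p :
  fp_eval h (word_elt w) p = eval_blocks h (wblocks w) (wconst0 w p).
Proof.
case: w => c0 bs; rewrite /word_elt /=.
have -> : c0 p = fp_eval h (fp_const r c0) p by rewrite fp_eval_const.
move: (fp_const r c0) => u.
elim: bs u => [//|[[i s] c] bs IH] u; rewrite [LHS]IH /=; congr eval_blocks.
rewrite !gmulfM !autME /= fp_eval_const; congr (c _).
by rewrite /signed; case: s; rewrite ?gmulfV /= fp_eval_var.
Qed.

Lemma agree_trans D D' h h' h'' : (forall i, D i `<=` D' i) ->
  agree D h h' -> agree D' h' h'' -> agree D h h''.
Proof.
by move=> DD' hh' h'h'' i x Dx; rewrite h'h'' ?hh' //; exact: DD'.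
Qed.

Lemma finite_signed_dom h D i s : finite_set (D i) ->
  finite_set (signed_dom h D i s).
Proof. by case: s => //=; exact: finite_image. Qed.

Lemma image_signed_dom h D i s :
  signed h i s @` signed_dom h D i s = signed_dom h D i (~~ s).
Proof. by case: s => //=; exact: image_autK. Qed.

Lemma not_acl_signed_dom h D i s p : ~ acl (signed_dom h D i s) p ->
  ~ acl (signed_dom h D i (~~ s)) (signed h i s p).
Proof. by rewrite -image_signed_dom; exact: not_acl_aut. Qed.

Lemma extend_partial h D i s p t : (forall j, finite_set (D j)) ->
  stab (signed_dom h D i (~~ s)) t ->
  let q := t (signed h i s p) in
  exists h' D',
    [/\ (forall j, finite_set (D' j)), (forall j, D j `<=` D' j), agree D h h' &
        (forall h'', agree D' h' h'' -> signed h'' i s p = q)] /\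
    [/\ signed_dom h' D' i s = signed_dom h D i s `|` [set p],
        signed_dom h' D' i (~~ s) = signed_dom h D i (~~ s) `|` [set q] &
        forall j s', j != i -> signed_dom h' D' j s' = signed_dom h D j s'].
Proof.
move=> finD tB q.
(* For an inverse letter [k] is chosen so that its inverse is the old letter followed by [t]; the
   newly frozen argument of [k] is then [q] instead of [p]. *)
pose k : aut M := if s then t^-1 * h i else h i * t.
pose h' j := if j == i then k else h j.
pose D' j := if j == i then D i `|` [set if s then q else p] else D j.
have h'i : h' i = k by rewrite /h' eqxx.
have D'i : D' i = D i `|` [set if s then q else p] by rewrite /D' eqxx.
have kD x : D i x -> k x = h i x.
  rewrite /k; case: s tB {q k h' D' h'i D'i} => tB Dx; rewrite autME.
    by rewrite (stabV tB).
  by rewrite tB //; exists x.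
have kpq : signed (fun=> k) i s p = q.
  rewrite /q /signed /k; case: (s) => //.
  by rewrite invgM invgK.
have imk : k @` D i = h i @` D i by apply: eq_imagel.
exists h', D'; split; split.
- by move=> j; rewrite /D'; case: eqP => // _; rewrite finite_setU.
- by move=> j x; rewrite /D'; case: eqP => [->|//]; left.
- by move=> j x; rewrite /h'; case: eqP => [->|//]; exact: kD.
- move=> h'' /(_ i); rewrite h'i D'i => /(_ _ (or_intror erefl)).
  case: (s) kpq => /= <-; rewrite /signed ?autVK => // h''E.
  by apply: (@aut_inj _ (h'' i)); rewrite autVK h''E.
- rewrite /signed_dom h'i D'i; case: (s) kpq => //= <-.
  by rewrite image_setU image_set1 imk autVK.
- rewrite /signed_dom h'i D'i; case: (s) kpq => //= <-.
  by rewrite image_setU image_set1 imk.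
- by move=> j s' ji; rewrite /signed_dom /h' /D' (negPf ji).
Qed.

Hypothesis oligoM : oligomorphic M.

(** Stated for lists of blocks, so that it passes to tails in the induction along the word. *)
Definition critical_evasive bs := forall ps qs i s c d,
  bs = ps ++ (i, s, c) :: (i, ~~ s, d) :: qs -> evasive c.

(** Induction on the remaining blocks; the invariant is that the current point lies outside the
    closure of the domain of the next letter. *)
Lemma extend_path i s c bs h D p (F : set M) :
  critical_evasive ((i, s, c) :: bs) -> (forall j, finite_set (D j)) ->
  finite_set F -> ~ acl (signed_dom h D i s) p ->
  exists h' D' y,
    [/\ (forall j, finite_set (D' j)), (forall j, D j `<=` D' j), agree D h h',
        ~ F y &
        forall h'', agree D' h' h'' -> eval_blocks h'' ((i, s, c) :: bs) p = y].
Proof.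
elim: bs i s c h D p => [|[[i' s'] c'] bs IH] i s c h D p evac finD finF np.
  have finB := finite_signed_dom h (~~ s) (finD i).
  have finc := finite_image (c^-1%g : aut M) finF.
  have [t tB nF] := stab_orbit_escape finB finc (not_acl_signed_dom np).
  have [h1 [D1 [[finD1 DD1 hh1 h1p] _]]] := extend_partial p finD tB.
  exists h1, D1, (c (t (signed h i s p))); split=> //.
    by move=> Fy; apply: nF; exists (c (t (signed h i s p))); rewrite ?autK.
  by move=> h'' /h1p /= ->.
pose q0 := signed h i s p.
have nq0 : ~ acl (signed_dom h D i (~~ s)) q0 by exact: not_acl_signed_dom.
have finB := finite_signed_dom h (~~ s) (finD i).
(* [t] must be chosen before the extension exists, so the invariant is required for every extension
   with the expected domains. *)
have [t tB good] : exists2 t, stab (signed_dom h D i (~~ s)) t &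
    forall h1 D1, [/\
        signed_dom h1 D1 i s = signed_dom h D i s `|` [set p],
        signed_dom h1 D1 i (~~ s) = signed_dom h D i (~~ s) `|` [set t q0] &
        forall j s', j != i -> signed_dom h1 D1 j s' = signed_dom h D j s'] ->
      ~ acl (signed_dom h1 D1 i' s') (c (t q0)).
  (* At a critical index the next domain contains [t q0] itself, and evasiveness is needed. *)
  have [[eqi eqs]|ncrit] := pselect (i' = i /\ s' = ~~ s).
    have [t [tB _ nacl]] :
        exists t, [/\ stab (signed_dom h D i (~~ s)) t, ~ set0 (t q0) &
          ~ acl (signed_dom h D i (~~ s) `|` [set t q0]) (c (t q0))].
      by apply: (evac [::] bs i s c c') => //; rewrite eqi eqs.
    by exists t => // h1 D1 [_ eqB _]; rewrite eqi eqs eqB.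
  (* Otherwise the next domain [E] does not depend on [t]: it gains [p] if the same letter repeats,
     and is unchanged for another variable. *)
  pose E := if i' == i then signed_dom h D i s `|` [set p]
            else signed_dom h D i' s'.
  have finE : finite_set E.
    rewrite /E; case: eqP => _; last exact: finite_signed_dom.
    rewrite finite_setU; split; last exact: finite_set1.
    exact: finite_signed_dom.
  have [t tB nE] := stab_orbit_escape finB
    (finite_image (c^-1%g : aut M) (finite_acl oligoM finE)) nq0.
  exists t => // h1 D1 [eqA _ eqj] acl1; apply: nE.
  exists (c (t q0)); last exact: autK.
  move: acl1; rewrite /E; case: eqP ncrit => [-> ncrit|/eqP ii' _]; last first.
    by rewrite eqj.
  suff -> : s' = s by rewrite eqA.
  by apply/eqP; rewrite -[_ == _]negbK; apply/negP => ss'; apply: ncrit;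
    split=> //; move: ss'; case: (s) (s') => [] [].
have [h1 [D1 [[finD1 DD1 hh1 h1p] doms]]] := extend_partial p finD tB.
have evac' : critical_evasive ((i', s', c') :: bs).
  move=> ps qs j sj cj d eqbs; apply: (evac ((i, s, c) :: ps) qs j sj cj d).
  by rewrite eqbs.
have [h' [D' [y [finD' D1D' h1h' nFy evy]]]] :=
  IH _ _ c' _ _ _ evac' finD1 finF (good _ _ doms).
exists h', D', y; split=> //.
- by move=> j; exact: subset_trans (D1D' j).
- exact: agree_trans hh1 h1h'.
move=> h'' h'h''; rewrite -(evy h'' h'h'') /=.
by rewrite (h1p h'') //; exact: agree_trans h1h' h'h''.
Qed.

Lemma extend_word (w : word (aut M) r) (infM : infinite_set [set: M]) n :
  0 < wlength w -> critical_evasive (wblocks w) ->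
  exists (x : nat -> M) h D, [/\ (forall j, finite_set (D j)),
    (forall k, (k < n.*2)%N ->
       ~ acl [set x j | j in [set j | (j < k)%N]] (x k)) &
    forall m h', (m < n)%N -> agree D h h' ->
      fp_eval h' (word_elt w) (x m.*2) = x m.*2.+1].
Proof.
rewrite /wlength => + evac.
case bsE: (wblocks w) evac => [//|[[i s] c] bs] evac _.
have out (F : set M) : finite_set F -> exists z, ~ F z.
  move=> finF; have [z [_ nz]] := infinite_setN0 (infinite_setD infM finF).
  by exists z.
elim: n => [|n [x [h [D [finD indep evx]]]]].
  have [z _] := out set0 (@finite_set0 _).
  by exists (fun=> z), (fun=> 1), (fun=> set0); split.
pose P := [set x j | j in [set j | (j < n.*2)%N]].
have finP : finite_set P by apply: finite_image; exact: finite_II.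
pose Q := acl (signed_dom h D i s).
have finQ : finite_set Q by apply: finite_acl => //; exact: finite_signed_dom.
(* The new source is independent of the earlier points, and its image under the initial constant
   avoids the closure of the first letter's domain. *)
have [a na] : exists a, ~ (acl P `|` ((wconst0 w)^-1%g : aut M) @` Q) a.
  apply: out; rewrite finite_setU.
  by split; [exact: finite_acl|exact: finite_image].
have finPa : finite_set (acl (P `|` [set a])).
  by apply: finite_acl; rewrite // finite_setU; split=> //; exact: finite_set1.
have nQ : ~ Q (wconst0 w a).
  by move=> Qa; apply: na; right; exists (wconst0 w a) => //; exact: autK.
have [h' [D' [b [finD' DD' hh' nb evb]]]] := extend_path evac finD finPa nQ.
pose x' k := if k == n.*2 then a else if k == n.*2.+1 then b else x k.
have x'E k : (k < n.*2)%N -> x' k = x k.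
  by move=> kn; rewrite /x' !ltn_eqF // ltnS ltnW.
have x'a : x' n.*2 = a by rewrite /x' eqxx.
have x'b : x' n.*2.+1 = b by rewrite /x' eqxx gtn_eqF.
exists x', h', D'; split=> //.
- move=> k; rewrite doubleS !ltnS leq_eqVlt => /orP[/eqP->|].
    rewrite x'b => aclb; apply: nb; apply: aclS aclb => _ [j /= jk <-].
    move: jk; rewrite ltnS leq_eqVlt => /orP[/eqP->|jn]; first by right.
    by left; exists j => //; rewrite x'E.
  rewrite ltnS leq_eqVlt => /orP[/eqP->|kn].
    rewrite x'a => acla; apply: na; left; apply: aclS acla => _ [j /= jk <-].
    by exists j => //; rewrite x'E.
  rewrite x'E // => aclk.
  apply: (indep k kn); apply: aclS aclk => _ [j /= jk <-].
  by exists j => //; rewrite x'E // (ltn_trans jk).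
move=> m h''; rewrite ltnS leq_eqVlt => /orP[/eqP->|mn] h'h''.
  by rewrite x'a x'b fp_eval_word_elt bsE; exact: evb.
rewrite !x'E ?ltn_double // ?ltn_Sdouble //; apply: evx => //.
exact: agree_trans DD' hh' h'h''.
Qed.

End Path.

(* From the conditions on critical constants to independent tuples *)
Local Close Scope group_scope.
Local Close Scope classical_set_scope.

Theorem theorem2p2p1 (M : relStructure) (r : nat) (w : word (aut M) r)
  (M_infinite : infinite_set [set: M]%classic)
  (M_homogeneous : homogeneous M)
  (M_oligomorphic : oligomorphic M)
  (w_reduced : reduced w)
  (w_length : 0 < wlength w)
  (w_cond : strong w \/
    (no_nontrivial_critical (@small M) w /\ algebraically_convex M) \/
    no_nontrivial_critical (@slender M) w) :
  (forall n : nat,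
     exists (alpha beta : 'I_n -> M) (h : 'I_r -> aut M),
       staggered_independent (interleave alpha beta) /\
       forall i : 'I_n, fp_eval h (word_elt w) (alpha i) = beta i) /\
  ~ mixed_identity (word_elt w).
Proof.
have evac : critical_evasive (wblocks w).
  move=> ps qs i s c d eqw.
  have crit : critical w (size ps).+1 c by exists ps, qs, i, s, d.
  (* Reducedness makes critical constants non-central, hence non-trivial, so conditions on
     non-trivial ones apply. *)
  have c1 : c <> 1%g.
    move=> c1; apply: (w_reduced _ _ crit) => g; rewrite c1.
    exact/commute_sym/commute1.
  case: w_cond => [/(_ _ _ crit)//|[[nsm convM]|nsl]].
    apply: (evasive_of_not_small M_oligomorphic M_homogeneous convM).
    exact: nsm crit c1.
  apply: (evasive_of_not_slender M_oligomorphic M_homogeneous).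
  exact: nsl crit c1.
have main n : exists (alpha beta : 'I_n -> M) (h : 'I_r -> aut M),
    staggered_independent (interleave alpha beta) /\
    forall i : 'I_n, fp_eval h (word_elt w) (alpha i) = beta i.
  have [x [h [D [_ indep evx]]]] :=
    extend_word M_oligomorphic M_infinite n w_length evac.
  exists (fun i => x i.*2), (fun i => x i.*2.+1), h; split; last first.
    by move=> i; exact: evx.
  have xE (k : 'I_n.*2) : interleave (fun i : 'I_n => x i.*2)
      (fun i : 'I_n => x i.*2.+1) k = x k.
    rewrite /interleave /= -[in RHS](odd_double_half k).
    by case: (odd k).
  move=> k; rewrite xE => aclk; apply: (indep k (ltn_ord k)).
  by apply: aclS aclk => _ [j jk <-]; exists j.
(* A mixed identity would force the target of a single pair to equal its source, against
   independence. *)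
split=> // -[_ w1]; have [a [b [h [indep ev]]]] := main 1%N.
have := indep (Ordinal (isT : 1 < 1.*2)); apply.
rewrite /interleave /=.
apply: sub_acl; exists (Ordinal (isT : 0 < 1.*2)) => //=.
rewrite /interleave /=.
have := ev (half_ord (Ordinal (isT : 0 < 1.*2))); rewrite w1 aut1E => ->.
by congr b; apply: val_inj.
Qed.
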